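(* Let $\alpha>0$, $\theta\in(0,\pi/2)$, $d=3$ and $l\in\mathbb{N}$, $l>0$. Then $\mathcal{C}_0^\infty(\overline{\mathbb{R}_+^2})\cap\mathrm{dom}\,Q^{[l]}_{\alpha,\Gamma_\theta}\subset\mathcal{C}_{0,0}^\infty(\overline{\mathbb{R}_+^2})$.
   Context: $\mathbb{R}^2_+:=\mathbb{R}_+\times\mathbb{R}$ with coordinates $(r,z)$, $r>0$. For $d=3$ and $l>0$ the quadratic form $Q^{[l]}_{\alpha,\Gamma_\theta}$ in $L^2(\mathbb{R}_+^2,r\,dr\,dz)$ is $$Q^{[l]}_{\alpha,\Gamma_\theta}[u]:=\int_{\mathbb{R}_+^2}\Big(|\partial_ru|^2+|\partial_zu|^2+\frac{l^2}{r^2}|u|^2\Big)r\,dr\,dz-\alpha\int_{\mathbb{R}_+}|u(s\sin\theta,s\cos\theta)|^2s\sin\theta\,ds,$$ with $\mathrm{dom}\,Q^{[l]}_{\alpha,\Gamma_\theta}=\{u:u,\partial_ru,\partial_zu,r^{-1}u\in L^2(\mathbb{R}_+^2,r\,dr\,dz)\}$. $\mathcal{C}_0^\infty(\overline{\mathbb{R}_+^2})$ is the space of infinitely differentiable functions with compact support in $\overline{\mathbb{R}_+^2}$ and $\mathcal{C}_{0,0}^\infty(\overline{\mathbb{R}_+^2}):=\{u\in\mathcal{C}_0^\infty(\overline{\mathbb{R}_+^2}):u|_{r=0}=0\}$. *)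

(* Defs.v *)
From HB Require Import structures.
From mathcomp Require Import all_boot all_order all_algebra.
From mathcomp Require Import complex.
From mathcomp Require Import all_classical all_reals all_analysis.
Import Order.TTheory GRing.Theory Num.Theory.
Import numFieldNormedType.Exports.

Set Implicit Arguments.
Unset Strict Implicit.
Unset Printing Implicit Defensive.

Local Open Scope classical_set_scope.
Local Open Scope ring_scope.

(* Points of the plane are pairs (r, z). Functions on the open or closed
   half-plane are total functions on R * R; every predicate below depends only
   on their values on the relevant half-plane. *)

Definition half_plane (R : realType) : set (R * R) := [set x | 0 < x.1].
Arguments half_plane R _ : clear implicits.

Definition closed_half_plane (R : realType) : set (R * R) :=
  [set x | 0 <= x.1].
Arguments closed_half_plane R _ : clear implicits.

Notation lebesgue2 R :=
  ((@lebesgue_measure R) \x (@lebesgue_measure R))%E.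

Definition e_r (R : realType) : R * R := (1, 0).
Definition e_z (R : realType) : R * R := (0, 1).

Definition re (R : realType) (u : R * R -> R[i]) : R * R -> R :=
  fun x => complex.Re (u x).
Definition im (R : realType) (u : R * R -> R[i]) : R * R -> R :=
  fun x => complex.Im (u x).

Fixpoint Ck (R : realType) (k : nat) (f : R * R -> R) : Prop :=
  match k with
  | 0%N => continuous f
  | k'.+1 => [/\ forall x : R * R, differentiable f x,
                 Ck k' ('D_(e_r R) f) & Ck k' ('D_(e_z R) f)]
  end.

Definition smooth (R : realType) (f : R * R -> R) : Prop :=
  forall k, Ck k f.

(* A function on the closed half-plane is infinitely differentiable when it is
   the restriction of an infinitely differentiable function on the plane. *)
Definition smooth_closed_half_plane (R : realType) (u : R * R -> R[i]) : Prop :=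
  exists U : R * R -> R[i],
    [/\ smooth (re U), smooth (im U) &
        forall x, closed_half_plane R x -> u x = U x].

Definition C0infty (R : realType) : set (R * R -> R[i]) :=
  [set u | smooth_closed_half_plane u /\
           compact (closure [set x | closed_half_plane R x /\ u x != 0])].
Arguments C0infty R _ : clear implicits.

Definition C00infty (R : realType) : set (R * R -> R[i]) :=
  [set u | C0infty R u /\ forall z : R, u (0, z) = 0].
Arguments C00infty R _ : clear implicits.

(* L^2(half_plane, r dr dz) *)
Definition L2 (R : realType) : set (R * R -> R[i]) :=
  [set u | [/\ measurable_fun (half_plane R) (re u),
               measurable_fun (half_plane R) (im u) &
     (\int[lebesgue2 R]_(x in half_plane R)
        ((re u x ^+ 2 + im u x ^+ 2) * x.1)%:E < +oo)%E]].
Arguments L2 R _ : clear implicits.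

Definition test_function (R : realType) : set (R * R -> R) :=
  [set phi | [/\ smooth phi, compact (closure [set x | phi x != 0]) &
                 closure [set x | phi x != 0] `<=` half_plane R]].
Arguments test_function R _ : clear implicits.

Definition weak_derivative_real (R : realType) (v : R * R)
    (f g : R * R -> R) : Prop :=
  forall phi, test_function R phi ->
    \int[lebesgue2 R]_(x in half_plane R) (f x * 'D_v phi x) =
    - \int[lebesgue2 R]_(x in half_plane R) (g x * phi x).

(* g is the distributional derivative of u in direction v on the open
   half-plane, with respect to dr dz. All integrals converge when u and g are
   in L2, since r is bounded below on the support of a test function. *)
Definition weak_derivative (R : realType) (v : R * R)
    (u g : R * R -> R[i]) : Prop :=
  weak_derivative_real v (re u) (re g) /\ weak_derivative_real v (im u) (im g).

(* The form domain, for l > 0: the condition on u is the same for all values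
   of the parameters alpha, theta and l. *)
Definition domQ (R : realType) (alpha theta : R) (l : nat) :
    set (R * R -> R[i]) :=
  [set u | [/\ L2 R u,
               exists2 g, L2 R g & weak_derivative (e_r R) u g,
               exists2 g, L2 R g & weak_derivative (e_z R) u g &
               L2 R (fun x => ((x.1)^-1)%:C%C * u x)]].

(* Main.v *)
Require Import Defs.
From HB Require Import structures.
From mathcomp Require Import all_boot all_order all_algebra.
From mathcomp Require Import complex.
From mathcomp Require Import all_classical all_reals all_analysis.
From mathcomp Require Import measurable_realfun ring lra.
Import Order.TTheory GRing.Theory Num.Theory.
Import numFieldNormedType.Exports.
Local Open Scope classical_set_scope.
Local Open Scope ring_scope.

(** If u(0, z0) <> 0 then, by continuity, |u|^2 >= c > 0 near (0, z0), so the
    density r |u / r|^2 dominates c / r there. Each of the disjoint dyadic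
    boxes d / 2^(n+1) < r < d / 2^n, |z - z0| < d contributes at least c d to
    the integral of c / r, which is therefore infinite. *)

Lemma measurable_half_plane (R : realType) : measurable (half_plane R).
Proof.
have -> : half_plane R = `]0, +oo[%classic `*` setT.
  by apply/seteqP; split=> [[r z]|[r z] []] /=; rewrite in_itv /= andbT.
exact: measurableX.
Qed.

Definition dyadic_box {R : realType} (z0 d : R) (n : nat) : set (R * R) :=
  `]d / 2 ^+ n.+1, d / 2 ^+ n[%classic `*` `]z0 - d, z0 + d[%classic.

Lemma measurable_dyadic_box {R : realType} (z0 d : R) (n : nat) :
  measurable (dyadic_box z0 d n).
Proof. exact: measurableX. Qed.

Lemma trivIset_dyadic_box {R : realType} (z0 d : R) (D : set nat) :
  0 < d -> trivIset D (dyadic_box z0 d).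
Proof.
move=> d0.
(* For m < n, box m lies in r > d / 2^(m+1) and box n in r < d / 2^n <= d / 2^(m+1); the open ends
   keep adjacent boxes apart. *)
have disj m n (x : R * R) : (m < n)%N ->
    dyadic_box z0 d m x -> dyadic_box z0 d n x -> False.
  move=> mn [/= + _] [/= + _]; rewrite !in_itv /= => /andP[xm _] /andP[_ xn].
  have := lt_trans xm xn; apply/negP; rewrite -leNgt ler_pM2l//.
  by rewrite lef_pV2 ?posrE ?exprn_gt0// ler_eXn2l// ltr1n.
move=> m n _ _ [x [xm xn]]; apply/eqP; case: (ltngtP m n) => // mn; exfalso.
- exact: (disj m n x).
- exact: (disj n m x).
Qed.

Lemma lebesgue2_dyadic_box {R : realType} (z0 d : R) (n : nat) : 0 < d ->
  lebesgue2 R (dyadic_box z0 d n) = (d / 2 ^+ n.+1 * (d *+ 2))%:E.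
Proof.
move=> d0; have p0 : (0 : R) < 2 ^+ n by rewrite exprn_gt0.
rewrite /dyadic_box product_measure1E//= !lebesgue_measure_itv/= !lte_fin.
(* The interval lengths are given by a case split on the order of the endpoints, settled here for r
   and next for z. *)
rewrite ltr_pM2l// ltf_pV2 ?posrE ?exprn_gt0// ltr_eXn2l ?ltr1n// ltnSn.
have -> : z0 - d < z0 + d by lra.
rewrite -!EFinB -EFinM exprS; congr (_%:E); field; exact: lt0r_neq0.
Qed.

(** On box n the bound c / r exceeds c 2^n / d, while the area is d^2 / 2^n. The powers of 2 cancel,
    so the bound c d does not depend on n. *)
Lemma integral_ge_inv_dyadic_box {R : realType} (h : R * R -> R) (z0 c d : R)
    (n : nat) :
  0 < c -> 0 < d -> measurable_fun (half_plane R) h ->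
  (forall x, 0 < x.1 < d -> z0 - d < x.2 < z0 + d -> c / x.1 <= h x) ->
  ((c * d)%:E <= \int[lebesgue2 R]_(x in dyadic_box z0 d n) (h x)%:E)%E.
Proof.
move=> c0 d0 mh hlb; have p0 : (0 : R) < 2 ^+ n by rewrite exprn_gt0.
have boxP x : dyadic_box z0 d n x ->
    [/\ 0 < x.1, x.1 < d / 2 ^+ n & z0 - d < x.2 < z0 + d].
  move=> [/=]; rewrite !in_itv /= => /andP[x1 x2] x3; split => //.
  by apply: lt_trans x1; rewrite divr_gt0 ?exprn_gt0.
(* The constant is the value of c / r at the outer edge r = d / 2^n. *)
have box_lb x : dyadic_box z0 d n x -> c * 2 ^+ n / d <= h x.
  move=> /boxP[x0 xd xz]; apply: le_trans (hlb _ _ xz).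
    rewrite -mulrA ler_pM2l// -[leLHS]invrK invf_div lef_pV2 ?posrE//.
      exact: ltW.
    exact: divr_gt0.
  rewrite x0/=; apply: lt_le_trans xd _.
  by rewrite ler_pdivrMr// ler_peMr ?(ltW d0)// exprn_ege1// ler1n.
have -> : (c * d)%:E = (\int[lebesgue2 R]_(x in dyadic_box z0 d n)
    cst (c * 2 ^+ n / d)%:E x)%E.
  rewrite integral_cst; last exact: measurable_dyadic_box.
  rewrite [X in (_ * X)%E]lebesgue2_dyadic_box// -EFinM exprS.
  by congr (_%:E); field; rewrite !lt0r_neq0.
apply: ge0_le_integral.
- exact: measurable_dyadic_box.
- by move=> x _; rewrite lee_fin !mulr_ge0 ?invr_ge0 ?ltW.
- exact: measurable_cst.
- apply/measurable_EFinP; apply: measurable_funS mh.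
    exact: measurable_half_plane.
  by move=> x /boxP[].
- by move=> x /box_lb; rewrite lee_fin.
Qed.

Lemma integral_ge_inv_half_plane_pinfty {R : realType} (h : R * R -> R)
    (z0 c d : R) :
  0 < c -> 0 < d -> measurable_fun (half_plane R) h ->
  (forall x, half_plane R x -> 0 <= h x) ->
  (forall x, 0 < x.1 < d -> z0 - d < x.2 < z0 + d -> c / x.1 <= h x) ->
  (\int[lebesgue2 R]_(x in half_plane R) (h x)%:E = +oo)%E.
Proof.
move=> c0 d0 mh h0 hlb.
set I := (\int[_]_(_ in _) _)%E.
suff I_ge N : ((N%:R * (c * d))%:E <= I)%E.
  (* The case N = 0 gives I >= 0, which rules out -oo. A finite value r is then exceeded by N c d,
     with N the Archimedean bound of r / (c d). *)
  have := I_ge 0%N; rewrite mul0r; case: I I_ge => [r| |] I_ge //.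
  rewrite lee_fin => r0.
  have /archi_boundP := divr_ge0 r0 (ltW (mulr_gt0 c0 d0)).
  rewrite ltr_pdivrMr ?mulr_gt0// => rN.
  by have := I_ge (Num.bound (r / (c * d))); rewrite lee_fin leNgt rN.
have mF n : measurable (dyadic_box z0 d n) by exact: measurable_dyadic_box.
have sF : \big[setU/set0]_(0 <= n < N) dyadic_box z0 d n `<=` half_plane R.
  apply: (big_ind (fun A => A `<=` half_plane R)) => [//|A B sA sB|n _].
    by rewrite subUset.
  move=> x [/= + _]; rewrite in_itv /= => /andP[+ _]; apply: lt_trans.
  by rewrite divr_gt0 ?exprn_gt0.
have mEh : measurable_fun (half_plane R) (EFin \o h) by exact/measurable_EFinP.
have mhp := measurable_half_plane R.
(* As h >= 0, the integral can only decrease on restriction to the first N boxes, where it is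
   additive by disjointness. *)
apply: (@le_trans _ _ (\int[lebesgue2 R]_(x in
    \big[setU/set0]_(0 <= n < N) dyadic_box z0 d n) (h x)%:E)%E); last first.
  apply: ge0_subset_integral => //; apply: bigsetU_measurable => n _.
  exact: measurable_dyadic_box.
rewrite ge0_integral_bigsetU//.
- rewrite mulr_natl -[in leLHS](subn0 N) -sumr_const_nat.
  rewrite -sumEFin; apply: lee_sum => n _.
  exact: integral_ge_inv_dyadic_box.
- exact: iota_uniq.
- exact: trivIset_dyadic_box.
- exact: measurable_funS mEh.
- by move=> x /sF /h0; rewrite lee_fin.
Qed.

Lemma continuous_sumsq_lower_bound {R : realType} {f g : R * R -> R} {z0 : R} :
  continuous f -> continuous g -> 0 < f (0, z0) ^+ 2 + g (0, z0) ^+ 2 ->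
  exists2 c, 0 < c & exists2 d, 0 < d & forall x,
    0 < x.1 < d -> z0 - d < x.2 < z0 + d -> c <= f x ^+ 2 + g x ^+ 2.
Proof.
move=> cf cg; set s := _ + _ => s0.
(* Half the value at (0, z0) leaves room for continuity to act. *)
exists (s / 2); first exact: divr_gt0.
have : f x ^+ 2 + g x ^+ 2 @[x --> ((0 : R), z0)] --> s.
  by apply: cvgD; rewrite expr2; apply: cvgM; [exact: cf..|exact: cg|exact: cg].
move/cvgr_gt => /(_ (s / 2)).
have -> : s / 2 < s by lra.
move=> /(_ isT) /nbhs_ballP[d /= d0 ball_d]; exists d => // x /andP[x0 xd] xz.
(* Balls of the product are squares, so each coordinate is checked separately. *)
apply/ltW/ball_d; split; rewrite /ball/= distrC ?subr0.
  by rewrite gtr0_norm.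
by rewrite ltr_distl.
Qed.

Theorem lemmaA3 (R : realType) (alpha theta : R) (l : nat)
    (halpha : 0 < alpha) (htheta0 : 0 < theta) (htheta1 : theta < pi / 2)
    (hl : (0 < l)%N) :
  C0infty R `&` domQ alpha theta l `<=` C00infty R.
Proof.
move=> u [uC0 [_ _ _ [mre mim ufin]]]; split => // z0.
(* Order 0 of smoothness is continuity of the extension [U] on the whole plane, hence also at the
   boundary point (0, z0), where [U] equals [u]. *)
have [[U [/(_ 0%N) cre /(_ 0%N) cim uU]] _] := uC0.
apply/eqP/negPn/negP => u0.
have : 0 < re U (0, z0) ^+ 2 + im U (0, z0) ^+ 2.
  rewrite /re /im -uU /closed_half_plane//=.
  rewrite lt_def addr_ge0 ?sqr_ge0// andbT paddr_eq0 ?sqr_ge0// !sqrf_eq0.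
  by apply: contra u0; case: (u _) => a b /= /andP[/eqP-> /eqP->].
move=> /(continuous_sumsq_lower_bound cre cim)[c c0 [d d0 Ulb]].
(* Here [h] is the density r |u / r|^2, whose integral [ufin] declares finite. *)
move: ufin; rewrite (integral_ge_inv_half_plane_pinfty _ z0 _ _ c0 d0) //.
- apply: measurable_funM.
    by apply: measurable_funD; apply: measurable_funX.
  exact: measurable_funTS measurable_fst.
- by move=> x x0; rewrite mulr_ge0 ?addr_ge0 ?sqr_ge0// ltW.
- move=> x x1 x2; have /andP[x0 _] := x1.
  have := Ulb x x1 x2; rewrite /re /im -uU; last exact: ltW.
  (* The factor 1 / r is real, so the cross terms of the complex product vanish and the density
     becomes (a^2 + b^2) / r. *)
  case: (u x) => a b /= cab; rewrite !mul0r subr0 addr0.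
  rewrite [leRHS](_ : _ = (a ^+ 2 + b ^+ 2) / x.1).
    by rewrite ler_pM2r// invr_gt0.
  by field; exact: lt0r_neq0.
Qed.
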